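(* Let $E'$ be a nonempty finite set of $m_{E'}=|E'|$ edges of a simple graph on vertex set $V$, and let $d_u$ denote the degree of $u\in V$ in the graph $(V,E')$. Define $\mathrm{Cost}(E')=\sum_{u\in V} d_u\left(1-\frac{d_u}{m_{E'}}\right)$. Then $m_{E'}-1\le \mathrm{Cost}(E')\le 2m_{E'}-1$. *)

(* Defs.v *)
From HB Require Import structures.
From mathcomp Require Import all_boot all_order all_algebra.
From mathcomp Require Import finmap.
From mathcomp Require Import classical_sets fsbigop.

Set Implicit Arguments.
Unset Strict Implicit.
Unset Printing Implicit Defensive.

Import Order.TTheory GRing.Theory Num.Theory.

Local Open Scope fset_scope.
Local Open Scope ring_scope.

Record simple_graph (V : choiceType) := SimpleGraph {
  adj : V -> V -> Prop;
  adj_sym : forall u v, adj u v -> adj v u;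
  adj_irr : forall u, ~ adj u u
}.

Definition is_edge (V : choiceType) (G : simple_graph V) (e : {fset V}) : Prop :=
  exists u v : V, adj G u v /\ e = [fset u; v].

Definition degree (V : choiceType) (E : {fset {fset V}}) (u : V) : nat :=
  #|` [fset e in E | u \in (e : {fset V})] |.

(* The index set is all of V. The sum \sum_(u \in A) is the finite-support sum
   of fsbigop: only the finitely many endpoints of edges of E contribute, all
   other vertices having degree 0. *)
Definition Cost (R : realFieldType) (V : choiceType) (E : {fset {fset V}}) : R :=
  \sum_(u \in [set: V]%classic)
    ((degree E u)%:R * (1 - (degree E u)%:R / (#|` E|)%:R) : R).

(* Main.v *)
Require Import Defs.
From mathcomp Require Import all_boot all_order all_algebra.
From mathcomp Require Import finmap.
From mathcomp Require Import fsbigop.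
From mathcomp Require Import ring lra.

Import GRing.Theory Num.Theory.

Local Open Scope fset_scope.
Local Open Scope ring_scope.

(** Write m for the number of edges.  Double counting incidences gives
    sum_u d_u = 2m and sum_u d_u^2 = sum_(uv in E) (d_u + d_v), so
    Cost E = 2m - (sum_u d_u^2) / m.  Two distinct vertices share at most one
    edge, hence d_u + d_v <= m + 1 on every edge, and sum_u d_u^2 <= m (m + 1);
    on the other side sum_u d_u^2 >= sum_u d_u = 2m >= m. *)

Lemma is_edgeP (V : choiceType) (G : simple_graph V) (e : {fset V}) :
  is_edge G e -> exists u v : V, u != v /\ e = [fset u; v].
Proof.
move=> [u [v [uv ->]]]; exists u, v; split=> //.
by apply/eqP => eq_uv; apply: (@adj_irr _ G u); rewrite {2}eq_uv.
Qed.

Lemma card_edge (V : choiceType) (G : simple_graph V) (e : {fset V}) :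
  is_edge G e -> #|` e| = 2%N.
Proof. by move=> /is_edgeP[u [v [uv ->]]]; rewrite cardfs2 uv. Qed.

Lemma degreeE (V : choiceType) (E : {fset {fset V}}) (u : V) :
  degree E u = (\sum_(e <- E) (u \in (e : {fset V})))%N.
Proof.
rewrite /degree card_fset_sum1 big_fset /= big_mkcond.
by apply: eq_bigr => e _; case: ifP.
Qed.

Lemma degree_notin_fcover (V : choiceType) (E : {fset {fset V}}) (u : V) :
  u \notin fcover E -> degree E u = 0%N.
Proof.
move=> uNE; rewrite degreeE big_seq big1 // => e eE.
by case: (boolP (u \in e)) => // ue; case/bigfcupP: uNE; exists e; rewrite ?eE.
Qed.

(** Weighted double counting of incident pairs. Constant weight 1 gives the handshake identity,
    weight [degree E] the sum of squared degrees. *)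
Lemma sum_degreeM (V : choiceType) (E : {fset {fset V}}) (F : V -> nat) :
  (\sum_(u <- fcover E) degree E u * F u =
   \sum_(e <- E) \sum_(u <- (e : {fset V})) F u)%N.
Proof.
under eq_bigr do rewrite degreeE big_distrl /=.
rewrite exchange_big /= big_seq [RHS]big_seq; apply: eq_bigr => e eE.
rewrite [RHS](eq_big_seq (fun u => ((u \in e) * F u)%N)); last first.
  by move=> u ->; rewrite mul1n.
(* Each edge lies inside the cover, and the indicator kills the vertices of the cover outside it. *)
apply/esym/big_fset_incl; first exact: bigfcup_sup.
by move=> u _ /negbTE ->.
Qed.

(** Inclusion-exclusion on the stars of [u] and [v]: their union lies in [E], and their intersection
    contains at most the edge [[fset u; v]]. *)
Lemma degreeD_le (V : choiceType) (E : {fset {fset V}}) (u v : V) :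
  (forall e : {fset V}, e \in E -> #|` e| = 2%N) -> u != v ->
  (degree E u + degree E v <= #|` E|.+1)%N.
Proof.
move=> E2 uv; rewrite /degree -cardfsUI -addn1; apply: leq_add.
  by apply: fsubset_leq_card; rewrite fsubUset !fset_sub.
rewrite -(cardfs1 [fset u; v]); apply: fsubset_leq_card.
apply/fsubsetP => e; rewrite !inE /= => /andP[/andP[eE ue] /andP[_ ve]].
(* Both sets have two elements, so the inclusion of [[fset u; v]] in [e] forces equality. *)
rewrite eq_sym eqEfcard E2 // cardfs2 uv andbT.
by apply/fsubsetP => w; rewrite !inE => /orP[] /eqP ->.
Qed.

Section DegreeSums.
Variables (V : choiceType) (G : simple_graph V) (E : {fset {fset V}}).
Hypothesis E_edges : forall e : {fset V}, e \in E -> is_edge G e.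

Let E2 (e : {fset V}) : e \in E -> #|` e| = 2%N.
Proof. by move=> /E_edges /card_edge. Qed.

Lemma sum_degree : (\sum_(u <- fcover E) degree E u = 2 * #|` E|)%N.
Proof.
under eq_bigr do rewrite -[degree E _]muln1.
rewrite sum_degreeM card_fset_sum1 big_distrr /=; apply: eq_big_seq => e eE.
by rewrite -card_fset_sum1 E2.
Qed.

Lemma sum_degree_sqr_le :
  (\sum_(u <- fcover E) degree E u * degree E u <= #|` E| * #|` E|.+1)%N.
Proof.
rewrite sum_degreeM [X in (_ <= X * _)%N]card_fset_sum1 big_distrl /=.
rewrite big_seq [leqRHS]big_seq; apply: leq_sum => e eE.
have [u [v [uv ->]]] := is_edgeP _ _ _ (E_edges _ eE).
by rewrite big_fsetU1 ?inE //= big_seq_fset1 mul1n degreeD_le.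
Qed.

Lemma sum_degree_sqr_ge :
  (2 * #|` E| <= \sum_(u <- fcover E) degree E u * degree E u)%N.
Proof.
(* Vertex by vertex, d <= d^2 for a natural number d, zero included. *)
by rewrite -sum_degree; apply: leq_sum => u _; case: degree => // n; rewrite leq_pmulr.
Qed.

Lemma CostE (R : realFieldType) :
  Cost R E = 2 * (#|` E|)%:R -
    (\sum_(u <- fcover E) degree E u * degree E u)%N%:R / (#|` E|)%:R.
Proof.
rewrite /Cost (fsbigTE (fcover E)); last first.
  by move=> u /degree_notin_fcover ->; rewrite mul0r.
(* Writing 2m back as the sum of degrees turns both sides into sums over the cover, so it is enough
   that d(1 - d/m) = d - d^2/m at each vertex. *)
rewrite -natrM -sum_degree !natr_sum mulr_suml -sumrB.
by apply: eq_bigr => u _; rewrite natrM; ring.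
Qed.

End DegreeSums.

Theorem proposition1 (R : realFieldType) (V : choiceType)
    (G : simple_graph V) (E' : {fset {fset V}})
    (E'_nonempty : E' != fset0)
    (E'_edges : forall e : {fset V}, e \in E' -> is_edge G e) :
  (#|` E'|)%:R - 1 <= Cost R E' /\ Cost R E' <= 2 * (#|` E'|)%:R - 1.
Proof.
have m_gt0 : 0 < (#|` E'|)%:R :> R by rewrite ltr0n cardfs_gt0.
rewrite (CostE _ _ _ E'_edges).
have := sum_degree_sqr_le _ _ _ E'_edges; have := sum_degree_sqr_ge _ _ _ E'_edges.
(* From here only 2m <= S <= m(m + 1) matters; dividing by m > 0 bounds S/m. *)
move: (\sum_(u <- _) _)%N => S.
rewrite -!(ler_nat R) !natrM -(natr1 #|` E'|) => S_ge S_le.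
have S_le' : S%:R / (#|` E'|)%:R <= (#|` E'|)%:R + 1 :> R.
  by rewrite ler_pdivrMr // mulrC.
have S_ge' : 1 <= S%:R / (#|` E'|)%:R :> R by rewrite ler_pdivlMr //; lra.
by split; lra.
Qed.
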